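(* Let $\varphi\colon\mathbb{N}\to\mathbb{R}^+$ be a function satisfying $\lim_{n\to\infty}\varphi(n)=\infty$, and for $x\in(0,1]$ and $n\ge2$ let $R'_n(x)=\frac{p'_n(x)}{p'_{n-1}(x)}$, where $p'_n(x)$ is the $n$th digit of the modified Engel expansion of $x$. Then $$\dim_H\left\{x\in(0,1]\colon\lim_{n\to\infty}\frac{\log R'_n(x)}{\varphi(n)}=1\right\}=\frac{1}{1+\theta},$$ where $$\theta=\limsup_{n\to\infty}\frac{\sum_{k=1}^{n+1}\varphi(k)}{\sum_{k=1}^{n}(n-k+1)\varphi(k)},$$ with the convention that $\frac{1}{1+\theta}=0$ if $\theta=\infty$.
   Context: $\mathbb{N}=\{1,2,3,\dots\}$; $\dim_H$ is the Hausdorff dimension. Modified Engel expansion: every $x\in(0,1]$ has a unique representation $$x=\frac{1}{p'_1}+\frac{1}{(p'_1-1)p'_2}+\frac{1}{(p'_1-1)(p'_2-1)p'_3}+\cdots$$ as an infinite series, with natural numbers $p'_1\ge2$ and $p'_{n+1}\ge p'_n+1$ for all $n$; put $p'_n(x)=p'_n$. *)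

(* Defs.v *)
From HB Require Import structures.
From mathcomp Require Import all_boot all_order all_algebra.
From mathcomp Require Import all_classical all_reals all_analysis.

Set Implicit Arguments.
Unset Strict Implicit.
Unset Printing Implicit Defensive.

Import Order.TTheory GRing.Theory Num.Theory.
Import numFieldNormedType.Exports.

Local Open Scope classical_set_scope.
Local Open Scope ring_scope.

Section Hausdorff.
Context {R : realType}.
Implicit Types (A U : set R) (s delta : R).
Local Open Scope ereal_scope.

(* With this formula diam set0 = -oo. *)
Definition diam U : \bar R :=
  ereal_sup [set (`|x - y|%R)%:E | x in U & y in U].

(* At s = 0 nonempty sets have weight 1 (including singletons, since
   0 `^ 0 = 1) and set0 has weight 0. *)
Definition diam_weight s U : \bar R :=
  if U == set0 then 0 else diam U `^ s.

Definition delta_cover delta A : set ((set R)^nat) :=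
  [set U | A `<=` \bigcup_i U i /\ forall i, diam (U i) <= delta%:E].

Definition hausdorff_premeasure s delta A : \bar R :=
  ereal_inf [set \sum_(0 <= i <oo) diam_weight s (U i)
            | U in delta_cover delta A].

Definition hausdorff_measure s A : \bar R :=
  ereal_sup [set hausdorff_premeasure s delta A
            | delta in [set delta : R | (0 < delta)%R]].

Definition hausdorff_dim A : \bar R :=
  ereal_inf [set s%:E | s in [set s : R
    | (0 <= s)%R /\ hausdorff_measure s A = 0]].

End Hausdorff.

Section ModifiedEngel.
Context {R : realType}.
Implicit Types (x : R) (p : nat -> nat).

(* Digit sequences, like all sequences below, are indexed from 1: the value
   p 0 is arbitrary and never matters. *)
Definition modified_engel_expansion x p : Prop :=
  [/\ (2 <= p 1)%N,
      forall n, (1 <= n)%N -> (p n + 1 <= p n.+1)%N &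
      \sum_(1 <= n < N.+1)
        1 / ((\prod_(1 <= k < n) ((p k)%:R - 1)) * (p n)%:R)
        @[N --> \oo] --> x].

(* For 0 < x <= 1 the expansion exists and is unique at the indices n >= 1. *)
Definition modified_engel_digit x : nat -> nat :=
  get [set p | modified_engel_expansion x p].

(* Only meaningful for n >= 2. *)
Definition modified_engel_ratio (n : nat) x : R :=
  (modified_engel_digit x n)%:R / (modified_engel_digit x n.-1)%:R.

(* The term n = 0 is 0 (division by an empty sum) and has no effect on the
   limsup. *)
Definition theta (phi : nat -> R) : \bar R :=
  limn_esup (fun n => ((\sum_(1 <= k < n.+2) phi k) /
    (\sum_(1 <= k < n.+1) (n - k + 1)%:R * phi k))%:E).

End ModifiedEngel.

(* Main.v *)
Require Import Defs.
From mathcomp Require Import all_boot all_order all_algebra.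
From mathcomp Require Import all_classical all_reals all_analysis.
From mathcomp Require Import lra ring.

Import Order.TTheory GRing.Theory Num.Theory.
Import numFieldNormedType.Exports.

Local Open Scope classical_set_scope.
Local Open Scope ring_scope.

(** Write [S n] for [phi 1 + ... + phi n] and [T n] for [S 1 + ... + S n], so
    that [theta phi] is the limsup of [S (n+1) / T n].  If [x] is in the set
    then summing the logarithms of the ratios shows that its [n]-th digit is
    about [exp (S n)], whence the product of its first [n] digits is about
    [exp (T n)].

    The points with given first [n] digits [p 1, ..., p n] whose next digit is
    [p n.+1] lie within [1 / ((p 1 - 1) ... (p n - 1) (p n.+1 - 1))] of the
    left end of the cylinder.

    Upper bound.  The set is therefore covered by about [exp (T n)] sets of
    diameter about [exp (- (T n + S (n+1)))], and this cover witnesses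
    dimension at most [T n / (T n + S (n+1))].  Choosing the [n] at which
    [S (n+1) / T n] comes near its limsup yields [1 / (1 + theta)].  The word
    about hides factors [exp (e * T n)] and [exp (C * n)]; the latter are
    negligible because [T n / n] tends to infinity
    ([premeasure_digit_band], [hausdorff_measure_ratio_set0]).

    Lower bound.  Put [a n = b 1 ... b n] with [b k] an integer close to
    [exp (phi k)], and let the [n]-th digit range freely from [a n] to
    [2 * a n - 1].  This gives a Cantor subset, parametrised by the half-open unit
    interval through the expansion of
    [z] in the mixed radix system with bases [a 1, a 2, ...].  Two points of the
    Cantor set whose digits first differ at a known place are separated by an
    explicit gap, so that the parametrisation satisfies
    [|z - z'| <= K * |x - x'| ^ t] whenever [t < 1 / (1 + theta)].  Covers of
    the Cantor set are thus pulled back to covers of the unit interval, whose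
    Lebesgue measure is 1
    ([cantor_gap], [cantor_holder], [hausdorff_measure_gt0]). *)

(** * Hausdorff premeasures and measures *)

Section Hausdorff.
Context {R : realType}.
Implicit Types (A U : set R) (s d : R).
Local Open Scope ereal_scope.

Lemma diam_set0 : diam (set0 : set R) = -oo.
Proof.
rewrite /diam (_ : [set _ | _ in _ & _ in _] = set0) ?ereal_sup0//.
by apply/seteqP; split=> // ? [? []].
Qed.

Lemma diam_ge0 U : U !=set0 -> 0 <= diam U.
Proof.
case=> x Ux; apply: ereal_sup_ubound; exists x => //; exists x => //.
by rewrite subrr normr0.
Qed.

Lemma diam_weight_ge0 s U : 0 <= diam_weight s U.
Proof. by rewrite /diam_weight; case: ifP => // _; exact: poweR_ge0. Qed.

Lemma diam_le U r : (forall x y, U x -> U y -> (`|x - y| <= r)%R) ->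
  diam U <= r%:E.
Proof.
by move=> h; apply: ge_ereal_sup => _ [x Ux [y Uy <-]]; rewrite lee_fin h.
Qed.

Lemma diam_weight_le s r U : (0 <= s)%R -> diam U <= r%:E -> (0 <= r)%R ->
  diam_weight s U <= (r `^ s)%:E.
Proof.
move=> s0 Ur r0; rewrite /diam_weight; case: ifPn => [_|/set0P/diam_ge0 dU].
  by rewrite lee_fin powR_ge0.
by rewrite -poweR_EFin gt0_ler_poweR// in_itv/= leey andbT.
Qed.

(** Giving infinite weight to the sets of large diameter turns the restriction on
    the diameters of a cover into a property of the weight, so that Hausdorff
    premeasures become outer measures induced by a set function. *)
Definition restricted_weight s d U : \bar R :=
  if diam U <= d%:E then diam_weight s U else +oo.

Let T := g_sigma_algebraType (setT : set (set R)).

Lemma restricted_weight0 s d : restricted_weight s d set0 = 0.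
Proof. by rewrite /restricted_weight diam_set0 leNye /diam_weight eqxx. Qed.

Lemma restricted_weight_ge0 s d U : 0 <= restricted_weight s d U.
Proof.
by rewrite /restricted_weight; case: ifP => // _; exact: diam_weight_ge0.
Qed.

(** The premeasure is the outer extension of a weight on the sigma-algebra of all
    subsets, hence inherits the general theory of such extensions. *)
Lemma hausdorff_premeasureE s d :
  hausdorff_premeasure s d = mu_ext (restricted_weight s d : set T -> \bar R).
Proof.
apply/funext => A; apply/eqP; rewrite eq_le; apply/andP; split.
  apply: le_ereal_inf_tmp => _ [U [_ AU] <-].
  have [Ud|] := pselect (forall i, diam (U i) <= d%:E).
    apply: ereal_inf_lbound; exists U => //=.
    by apply: eq_eseriesr => i _; rewrite /restricted_weight Ud.
  move=> /existsNP[i Ui]; rewrite (eseries_pinfty _ (k := i)) ?leey//.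
    by move=> n _; rewrite -ltNye (lt_le_trans _ (restricted_weight_ge0 _ _ _)).
  by rewrite /restricted_weight ifF//; apply/negP.
apply: le_ereal_inf_tmp => _ [U [AU Ud] <-].
apply: ereal_inf_lbound; exists U => /=.
  by split => // i; apply: sub_sigma_algebra.
by apply: eq_eseriesr => i _; rewrite /restricted_weight Ud.
Qed.

Lemma hausdorff_premeasure_ge0 s d A : 0 <= hausdorff_premeasure s d A.
Proof.
by rewrite hausdorff_premeasureE; apply: mu_ext_ge0; exact: restricted_weight_ge0.
Qed.

Lemma hausdorff_premeasure0 s d : hausdorff_premeasure s d set0 = 0.
Proof.
by rewrite hausdorff_premeasureE; apply: mu_ext0;
  [exact: restricted_weight0|exact: restricted_weight_ge0].
Qed.

Lemma le_hausdorff_premeasure s d :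
  {homo hausdorff_premeasure s d : A B / A `<=` B >-> A <= B}.
Proof.
move=> A B AB; apply: ereal_inf_le_tmp => _ [U [BU Ud] <-].
by exists U => //; split=> //; apply: subset_trans BU.
Qed.

Lemma hausdorff_premeasure_sigma_subadditive s d (F : (set R)^nat) A :
  A `<=` \bigcup_n F n ->
  hausdorff_premeasure s d A <= \sum_(n <oo) hausdorff_premeasure s d (F n).
Proof.
move=> AF; apply: (le_trans (le_hausdorff_premeasure s d _ _ AF)).
rewrite hausdorff_premeasureE; exact/mu_ext_sigma_subadditive/restricted_weight_ge0.
Qed.

Lemma hausdorff_premeasure_le_powR s d r A : (0 <= s)%R -> (0 <= r <= d)%R ->
  diam A <= r%:E -> hausdorff_premeasure s d A <= (r `^ s)%:E.
Proof.
move=> s0 /andP[r0 rd] Ar.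
pose U i := if i is 0%N then A else set0.
apply: (@le_trans _ _ (\sum_(i <oo) diam_weight s (U i))).
  apply: ereal_inf_lbound; exists U => //=; split => [x Ax|[|i]/=].
  - by exists 0%N.
  - by rewrite (le_trans Ar) ?lee_fin.
  - by rewrite diam_set0 leNye.
rewrite nneseries_recl//; last by move=> *; exact: diam_weight_ge0.
rewrite eseries0 ?adde0; first exact: diam_weight_le.
by move=> [|i]//= _ _; rewrite /diam_weight eqxx.
Qed.

Lemma hausdorff_measure_bigcup0 s A (F : (set R)^nat) : A `<=` \bigcup_n F n ->
  (forall n d, (0 < d)%R -> hausdorff_premeasure s d (F n) = 0) ->
  hausdorff_measure s A = 0.
Proof.
move=> AF F0; apply/eqP; rewrite eq_le; apply/andP; split.
  apply: ge_ereal_sup => _ [d /= d0 <-].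
  apply: (le_trans (hausdorff_premeasure_sigma_subadditive s d _ _ AF)).
  by rewrite eseries0// => n _ _; rewrite F0.
apply: (le_trans (hausdorff_premeasure_ge0 s 1 A)).
by apply: ereal_sup_ubound; exists 1%R => //=.
Qed.

(** A set that maps onto the half-open unit interval by an [s]-Hoelder map (of
    which [g] is a section) is not [s]-negligible: a cover of [A] is pulled back
    by [g] to a cover of that interval, the part coming from [U i] has diameter
    at most [K] times the weight of [U i], and the Lebesgue measure of the
    interval is 1. *)
Lemma hausdorff_measure_gt0 s (K : R) (g : R -> R) A :
  (0 <= s)%R -> (0 < K)%R ->
  (forall z, (0 <= z < 1)%R -> A (g z)) ->
  (forall z z', (0 <= z < 1)%R -> (0 <= z' < 1)%R ->
    (`|z - z'| <= K * `|g z - g z'| `^ s)%R) ->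
  0 < hausdorff_measure s A.
Proof.
move=> s0 K0 gA gK.
suff : (2 * K)^-1%:E <= hausdorff_premeasure s 1 A.
  move=> h; apply: (@lt_le_trans _ _ (hausdorff_premeasure s 1 A)).
    by apply: lt_le_trans h; rewrite lte_fin invr_gt0 mulr_gt0.
  by apply: ereal_sup_ubound; exists 1%R => //=.
apply: le_ereal_inf_tmp => _ [U [AU Ud] <-].
pose w i := fine (diam_weight s (U i)).
have wE i : diam_weight s (U i) = (w i)%:E.
  rewrite fineK// ge0_fin_numE; last exact: diam_weight_ge0.
  by apply: le_lt_trans (diam_weight_le s _ _ s0 (Ud i) _) _ => //; rewrite ltey.
have w0 i : (0 <= w i)%R by rewrite -lee_fin -wE diam_weight_ge0.
pose V i := [set z | (0 <= z < 1)%R /\ U i (g z)].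
have VU i z z' : V i z -> V i z' -> (`|z - z'| <= K * w i)%R.
  move=> [z1 Uz] [z1' Uz']; apply: (le_trans (gK _ _ z1 z1')).
  rewrite ler_pM2l// -lee_fin -wE /diam_weight ifF; last first.
    by apply/negbTE/set0P; exists (g z).
  rewrite -poweR_EFin gt0_ler_poweR ?in_itv//= ?leey ?andbT ?lee_fin//.
    by apply: diam_ge0; exists (g z).
  by apply: ereal_sup_ubound; exists (g z) => //; exists (g z').
have [c cV] : {c : nat -> R & forall i, V i !=set0 -> V i (c i)}.
  apply: (@choice _ _ (fun i z => V i !=set0 -> V i z)) => i.
  by have [[z Vz]|h] := pselect (V i !=set0); [exists z|exists 0%R].
(* The diameter bound puts the pullback of [U i] in an interval around one of
   its points; this wastes a factor 2, which is harmless. *)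
pose B i : set R := [set` `[(c i - K * w i)%R, (c i + K * w i)%R]].
have UB : `[0%R, 1%R[%classic `<=` \bigcup_i B i.
  move=> z /=; rewrite in_itv/= => z01.
  have [i _ Ui] := AU _ (gA _ z01); exists i => //.
  have Vz : V i z by [].
  have Vc : V i (c i) by apply: cV; exists z.
  have := VU _ _ _ Vz Vc.
  by rewrite /B /= in_itv/= ler_norml => /andP[? ?]; apply/andP; split; lra.
have : lebesgue_measure (`[0%R, 1%R[%classic : set R) <=
    \sum_(i <oo) lebesgue_measure (B i).
  by apply: measure_sigma_subadditive => // i; exact: measurable_itv.
rewrite lebesgue_measure_itv/= lte_fin ltr01 oppr0 adde0 => h.
rewrite -(@lee_pmul2l _ (2 * K)%:E) ?lte_fin ?mulr_gt0//.
rewrite -EFinM mulfV ?gt_eqF ?mulr_gt0//.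
rewrite -nneseriesZl; last by move=> *; exact: diam_weight_ge0.
apply: (le_trans h); apply: lee_nneseries => // i _.
rewrite wE lebesgue_measure_itv/= lte_fin -EFinM.
have := mulr_ge0 (ltW K0) (w0 i).
by case: ifP => _ ?; rewrite -?EFinB lee_fin; lra.
Qed.

End Hausdorff.

(** * Modified Engel expansions *)

Section EngelTheory.
Context {R : realType}.
Implicit Types (x y : R) (p q : nat -> nat).

Definition engel_digits p :=
  (2 <= p 1)%N /\ forall n, (1 <= n)%N -> (p n + 1 <= p n.+1)%N.

Definition engel_prod p n : R := \prod_(1 <= k < n.+1) ((p k)%:R - 1).

Definition engel_sum p N : R :=
  \sum_(1 <= n < N.+1) 1 / ((\prod_(1 <= k < n) ((p k)%:R - 1)) * (p n)%:R).

Lemma engel_prodS p n :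
  engel_prod p n.+1 = engel_prod p n * ((p n.+1)%:R - 1).
Proof. by rewrite /engel_prod big_nat_recr. Qed.

Lemma engel_sumS p n :
  engel_sum p n.+1 = engel_sum p n + 1 / (engel_prod p n * (p n.+1)%:R).
Proof. by rewrite /engel_sum big_nat_recr. Qed.

Lemma engel_digit_gt p n : engel_digits p -> (1 <= n)%N -> (n < p n)%N.
Proof.
case=> p1 pS; elim: n => // -[_ _|n /(_ isT) IH _]; first exact: p1.
by apply: leq_trans (pS _ _) => //; rewrite addn1.
Qed.

Lemma engel_digit_sub1_ge1 p n : engel_digits p -> (1 <= n)%N ->
  1 <= (p n)%:R - 1 :> R.
Proof.
move=> pP n1; rewrite lerBrDr -[1 + 1]/2%:R ler_nat.
exact: leq_ltn_trans n1 (engel_digit_gt _ _ pP n1).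
Qed.

Lemma engel_prod_gt0 p n : engel_digits p -> 0 < engel_prod p n.
Proof.
move=> pP; rewrite /engel_prod big_nat_cond prodr_gt0// => k.
by rewrite andbT => /andP[k1 _]; rewrite (lt_le_trans ltr01) ?engel_digit_sub1_ge1.
Qed.

(** The upper end of the part of a cylinder of order [n] where the next digit is
    [p n.+1]. *)
Definition engel_ub p n : R :=
  engel_sum p n + 1 / (engel_prod p n * ((p n.+1)%:R - 1)).

(** The telescoping [1 / (p - 1) = 1 / p + 1 / ((p - 1) * p)] makes the cylinders
    of the modified expansion tile the interval. *)
Lemma engel_ubE p n : engel_digits p ->
  engel_ub p n = engel_sum p n.+1 + 1 / (engel_prod p n.+1 * (p n.+1)%:R).
Proof.
move=> pP; rewrite /engel_ub engel_sumS engel_prodS.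
have := engel_prod_gt0 p n pP; have := engel_digit_sub1_ge1 p n.+1 pP isT.
move: (engel_prod p n) ((p n.+1)%:R) => u v v1 u0.
rewrite -addrA; congr (_ + _); field.
by rewrite !gt_eqF//; lra.
Qed.

Lemma engel_ub_nonincreasing p n : engel_digits p ->
  engel_ub p n.+1 <= engel_ub p n.
Proof.
move=> pP; rewrite [leRHS]engel_ubE// /engel_ub lerD2l.
have u0 := engel_prod_gt0 p n.+1 pP.
have v1 := engel_digit_sub1_ge1 p n.+1 pP isT.
rewrite ler_pM2l// lef_pV2 ?posrE ?mulr_gt0//; last first.
- by lra.
- by have := engel_digit_sub1_ge1 p n.+2 pP isT; lra.
rewrite ler_pM2l// lerBrDr natr1 -addn1 ler_nat.
by case: pP => _; exact.
Qed.

Lemma engel_sum_lt_ub p n : engel_digits p -> engel_sum p n < engel_ub p n.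
Proof.
move=> pP; rewrite /engel_ub ltrDl divr_gt0// mulr_gt0 ?engel_prod_gt0//.
by rewrite (lt_le_trans ltr01) ?engel_digit_sub1_ge1.
Qed.

Lemma engel_sum_increasing p : engel_digits p ->
  {homo engel_sum p : m n / (m <= n)%N >-> m <= n}.
Proof.
move=> pP; apply: homo_leq => [//|y x z|n]; first exact: le_trans.
rewrite engel_sumS lerDl divr_ge0// mulr_ge0// ltW//; exact: engel_prod_gt0.
Qed.

Lemma engel_sum_le_ub p m n : engel_digits p -> engel_sum p m <= engel_ub p n.
Proof.
move=> pP; have [mn|nm] := leqP m n.
  by rewrite (le_trans (engel_sum_increasing p pP _ _ mn)) ?ltW ?engel_sum_lt_ub.
apply: (le_trans (ltW (engel_sum_lt_ub p m pP))).
rewrite -(subnKC (ltnW nm)); elim: (m - n)%N => [|k IH]; first by rewrite addn0.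
by rewrite addnS (le_trans (engel_ub_nonincreasing _ _ pP)).
Qed.

Lemma engel_expansionP x p : modified_engel_expansion x p <->
  engel_digits p /\ engel_sum p n @[n --> \oo] --> x.
Proof. by split=> [[]|[[]]]. Qed.

Lemma engel_expansion_exists p : engel_digits p ->
  exists x, modified_engel_expansion x p.
Proof.
move=> pP; exists (limn (engel_sum p)).
apply/engel_expansionP; split=> //.
apply: nondecreasing_is_cvgn; first exact: engel_sum_increasing.
by exists (engel_ub p 0) => _ [n _ <-]; exact: engel_sum_le_ub.
Qed.

Lemma engel_expansion_bounds x p n : modified_engel_expansion x p ->
  engel_sum p n.+1 < x <= engel_ub p n.
Proof.
move=> /engel_expansionP[pP px]; apply/andP; split.
  apply: (@lt_le_trans _ _ (engel_sum p n.+2)).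
    rewrite [ltRHS]engel_sumS ltrDl divr_gt0// mulr_gt0 ?engel_prod_gt0//.
    by rewrite ltr0n; exact: leq_ltn_trans (engel_digit_gt p n.+2 pP isT).
  rewrite -(cvg_lim _ px)//; apply: nondecreasing_cvgn_le.
    exact: engel_sum_increasing.
  by apply/cvg_ex; exists x.
rewrite -(cvg_lim _ px)//; apply: limr_le; first by apply/cvg_ex; exists x.
by apply: nearW => m; exact: engel_sum_le_ub.
Qed.

Lemma engel_expansion_itv x p : modified_engel_expansion x p -> 0 < x <= 1.
Proof.
move=> xp; have [pP _] := (engel_expansionP _ _).1 xp.
have /andP[+ +] := engel_expansion_bounds x p 0 xp.
rewrite engel_sumS /engel_ub.
have -> : engel_sum p 0 = 0 by rewrite /engel_sum big_geq.
have -> : engel_prod p 0 = 1 by rewrite /engel_prod big_geq.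
rewrite !add0r !mul1r => x0 x1.
have p1 := engel_digit_sub1_ge1 p 1 pP isT.
rewrite (lt_trans _ x0) ?invr_gt0 ?(le_trans x1) ?invf_le1//; lra.
Qed.

Lemma engel_prod_ext p q n : (forall k, (1 <= k <= n)%N -> p k = q k) ->
  engel_prod p n = engel_prod q n.
Proof. by move=> pq; apply: eq_big_nat => k kn; rewrite pq. Qed.

Lemma engel_sum_ext p q n : (forall k, (1 <= k <= n)%N -> p k = q k) ->
  engel_sum p n = engel_sum q n.
Proof.
move=> pq; apply: eq_big_nat => k /andP[k1 kn]; rewrite pq ?k1//.
congr (1 / (_ * _)); apply: eq_big_nat => j /andP[j1 jk]; rewrite pq// j1/=.
by rewrite -ltnS (ltn_trans jk).
Qed.

(** The digits before place [n + 1] fix a common cylinder, in which larger next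
    digits lie further left.  The first two terms measure the cylinders
    strictly between the two points; the last one, all that remains for
    consecutive digits, is the part of the cylinder of [p] to the left of the
    points whose next digit is [p n.+2]. *)
Lemma engel_expansion_gap x y p q n :
  modified_engel_expansion x p -> modified_engel_expansion y q ->
  (forall k, (1 <= k <= n)%N -> p k = q k) -> (p n.+1 < q n.+1)%N ->
  (1 / (p n.+1)%:R - 1 / ((q n.+1)%:R - 1)
    + 1 / (((p n.+1)%:R - 1) * (p n.+2)%:R)) / engel_prod p n < x - y.
Proof.
move=> xp yq pq pqn.
have [pP _] := (engel_expansionP _ _).1 xp.
have [qP _] := (engel_expansionP _ _).1 yq.
have /andP[+ _] := engel_expansion_bounds x p n.+1 xp.
have /andP[_ +] := engel_expansion_bounds y q n yq.
rewrite !engel_sumS engel_prodS /engel_ub -(engel_prod_ext _ _ _ pq).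
rewrite -(engel_sum_ext _ _ _ pq).
have u0 := engel_prod_gt0 p n pP.
have p1 := engel_digit_sub1_ge1 p n.+1 pP isT.
have p2 := engel_digit_sub1_ge1 p n.+2 pP isT.
have q1 := engel_digit_sub1_ge1 q n.+1 qP isT.
move=> hy hx; apply: (@le_lt_trans _ _ ((engel_sum p n
  + 1 / (engel_prod p n * (p n.+1)%:R)
  + 1 / (engel_prod p n * ((p n.+1)%:R - 1) * (p n.+2)%:R)) -
  (engel_sum p n + 1 / (engel_prod p n * ((q n.+1)%:R - 1))))); last lra.
rewrite le_eqVlt; apply/orP; left; apply/eqP.
move: (engel_prod p n) u0 (engel_sum p n) => u u0 s.
by field; rewrite !gt_eqF//; lra.
Qed.

(** At the first place where two expansions differ, the gap between the two values
    would be positive. *)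
Lemma engel_expansion_unique x p q :
  modified_engel_expansion x p -> modified_engel_expansion x q ->
  forall n, (1 <= n)%N -> p n = q n.
Proof.
suff lt_gap p' q' n : modified_engel_expansion x p' ->
    modified_engel_expansion x q' ->
    (forall k, (1 <= k <= n)%N -> p' k = q' k) -> ~ (p' n.+1 < q' n.+1)%N.
  move=> xp xq n; elim/ltn_ind: n => -[//|n] IH _.
  have pq k : (1 <= k <= n)%N -> p k = q k by case/andP=> k1 kn; exact: IH.
  case: (ltngtP (p n.+1) (q n.+1)) => // h; first by case: (lt_gap p q n).
  by case: (lt_gap q p n) => // k kn; rewrite pq.
move=> xp xq pq pqn; have := engel_expansion_gap _ _ _ _ _ xp xq pq pqn.
apply/negP; rewrite -leNgt subrr divr_ge0//; last first.
  exact/ltW/engel_prod_gt0/((engel_expansionP _ _).1 xp).1.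
have [pP _] := (engel_expansionP _ _).1 xp.
have p1 := engel_digit_sub1_ge1 p' n.+1 pP isT.
have p2 := engel_digit_sub1_ge1 p' n.+2 pP isT.
rewrite addr_ge0//; last by rewrite divr_ge0// mulr_ge0//; lra.
have pq1 : (p' n.+1)%:R <= (q' n.+1)%:R - 1 :> R.
  by rewrite lerBrDr natr1 ler_nat.
by rewrite subr_ge0 !div1r lef_pV2 ?posrE//; lra.
Qed.

Lemma modified_engel_digitE x p : modified_engel_expansion x p ->
  forall n, (1 <= n)%N -> modified_engel_digit x n = p n.
Proof.
move=> xp; apply: engel_expansion_unique (xp); rewrite /modified_engel_digit.
exact: (getI xp).
Qed.

End EngelTheory.

(** * Partial sums and the quantity theta *)

Section Growth.
Context {R : realType}.
Implicit Types (u phi : nat -> R).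

Definition psum u n : R := \sum_(1 <= k < n.+1) u k.

Lemma psum0 u : psum u 0 = 0.
Proof. by rewrite /psum big_geq. Qed.

Lemma psumS u n : psum u n.+1 = psum u n + u n.+1.
Proof. by rewrite /psum big_nat_recr. Qed.

Lemma psum_ge0 u n : (forall k, (1 <= k)%N -> 0 <= u k) -> 0 <= psum u n.
Proof.
move=> u0; rewrite /psum big_nat_cond sumr_ge0// => k.
by move=> /andP[/andP[? _] _]; exact: u0.
Qed.

(** The denominator in [theta] is an iterated partial sum. *)
Lemma psum_psumE u n :
  psum (psum u) n = \sum_(1 <= k < n.+1) (n - k + 1)%:R * u k.
Proof.
elim: n => [|n IH]; first by rewrite psum0 big_geq.
rewrite psumS IH [RHS]big_nat_recr//= subnn add0n mul1r psumS addrA; congr (_ + _).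
rewrite /psum -big_split; apply: eq_big_nat => k /andP[_ kn].
by rewrite subSn// addSn -natr1 mulrDl mul1r.
Qed.

Lemma near_nat (P : nat -> Prop) : (\forall n \near \oo, P n) <->
  exists N, forall n, (N <= n)%N -> P n.
Proof. by split => [[N _ NP]|[N NP]]; exists N. Qed.

(** Terms beyond rank [N] exceed [|B| + 1], so the sum exceeds
    [(|B| + 1) * (n - N)]; applied to [phi] and to its partial sums, this makes
    all errors linear in [n] negligible against iterated sums. *)
Lemma psum_superlinear u B :
  (forall n, (1 <= n)%N -> 0 <= u n) -> u n @[n --> \oo] --> +oo ->
  \forall n \near \oo, B * n%:R <= psum u n.
Proof.
move=> u0 /cvgryPge/(_ (`|B| + 1))/near_nat[N uN].
have lb n : (`|B| + 1) * (n%:R - N%:R) <= psum u n.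
  elim: n => [|n IH].
    by rewrite psum0 sub0r mulrN oppr_le0 mulr_ge0// addr_ge0.
  rewrite psumS -natr1; have [Nn|nN] := leqP N n.+1.
    by have := uN _ Nn; lra.
  apply: (@le_trans _ _ 0); last by rewrite addr_ge0 ?u0// psum_ge0.
  rewrite mulr_ge0_le0// ?addr_ge0// subr_le0 natr1 ler_nat; exact: ltnW.
have [M MB] : exists M, (`|B| + 1) * N%:R <= M%:R.
  by exists (Num.truncn ((`|B| + 1) * N%:R)).+1; apply/ltW/truncnS_gt.
apply/near_nat; exists M => n; rewrite -(ler_nat R) => Mn.
apply: le_trans (lb n); have := ler_norm B.
have : 0 <= n%:R :> R by [].
nra.
Qed.

Lemma psum_cvgy u : (forall n, (1 <= n)%N -> 0 <= u n) ->
  u n @[n --> \oo] --> +oo -> psum u n @[n --> \oo] --> +oo.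
Proof.
move=> u0 uy; apply/cvgryPge => A.
have /near_nat[N uN] := psum_superlinear u `|A| u0 uy.
apply/near_nat; exists N.+1 => n Nn; apply: le_trans (uN _ (ltnW Nn)).
apply: (le_trans (ler_norm A)); rewrite ler_peMr// ler1n.
exact: leq_trans Nn.
Qed.

Definition theta_term phi n := psum phi n.+1 / psum (psum phi) n.

Lemma thetaE phi : theta phi = limn (esups (fun n => (theta_term phi n)%:E)).
Proof.
rewrite /theta limn_esup_lim; congr (limn (esups _)).
by apply/funext => n; rewrite /theta_term psum_psumE.
Qed.

Lemma theta_inf phi :
  theta phi = ereal_inf (range (esups (fun n => (theta_term phi n)%:E))).
Proof. by rewrite thetaE; apply: cvg_lim => //; exact: cvg_esups_inf. Qed.

Lemma theta_lt phi (r : R) : (theta phi < r%:E)%E ->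
  \forall n \near \oo, theta_term phi n < r.
Proof.
rewrite theta_inf => /ereal_inf_lt[_ [N _ <-]] h.
apply/near_nat; exists N => n Nn; rewrite -lte_fin; apply: le_lt_trans h.
by apply: ereal_sup_ubound; exists n.
Qed.

Lemma theta_gt phi (r : R) N : (r%:E < theta phi)%E ->
  exists2 n, (N <= n)%N & r < theta_term phi n.
Proof.
rewrite theta_inf => h.
have : (r%:E < esups (fun n => (theta_term phi n)%:E) N)%E.
  by apply: (lt_le_trans h); apply: ereal_inf_lbound; exists N.
by move=> /ereal_sup_gt[_ [n Nn <-]]; rewrite lte_fin; exists n.
Qed.

Lemma theta_ge0 phi : (forall n, (1 <= n)%N -> 0 < phi n) -> (0 <= theta phi)%E.
Proof.
move=> phi0; rewrite theta_inf; apply: le_ereal_inf_tmp => _ [N _ <-].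
apply: (@le_trans _ _ (theta_term phi N)%:E).
  rewrite lee_fin divr_ge0// !psum_ge0// => k k1; rewrite ?psum_ge0// => *;
    exact/ltW/phi0.
by apply: ereal_sup_ubound; exists N => //=.
Qed.

End Growth.

(** * Covers by cylinders with digits in a band *)

Section UpperCover.
Context {R : realType}.
Implicit Types (lam mu phi : nat -> R) (p q : nat -> nat) (x y s d : R).

Definition digit_band lam mu : set R := [set x | exists2 p,
  modified_engel_expansion x p & forall k, (1 <= k)%N ->
    lam k <= ln ((p k)%:R - 1 : R) /\ ln ((p k)%:R : R) <= mu k].

Definition digit_band_cylinder lam mu q n : set R := [set x | exists p,
  [/\ modified_engel_expansion x p, forall k, (1 <= k)%N ->
    lam k <= ln ((p k)%:R - 1 : R) /\ ln ((p k)%:R : R) <= mu k &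
  forall k, (1 <= k <= n)%N -> p k = q k]].

(** The reciprocal of the product of the lower bounds for [p k - 1] over
    [k <= n + 1]. *)
Definition band_diam lam n : R := expR (- (psum lam n + lam n.+1)).

Lemma expR_psum_le_engel_prod lam p n : engel_digits p ->
  (forall k, (1 <= k)%N -> lam k <= ln ((p k)%:R - 1 : R)) ->
  expR (psum lam n) <= engel_prod p n.
Proof.
move=> pP lamp; rewrite /psum expR_sum /engel_prod.
rewrite big_nat_cond [leRHS]big_nat_cond ler_prod// => k.
rewrite andbT => /andP[k1 _]; rewrite expR_ge0/=.
rewrite -[leRHS]lnK ?ler_expR ?lamp// posrE (lt_le_trans ltr01)//.
exact: engel_digit_sub1_ge1.
Qed.

(** The lower bound on the next digit confines the points to a left portion of the
    cylinder; when digits grow fast it is much shorter than the cylinder itself. *)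
Lemma diam_digit_band_cylinder lam mu q n :
  (diam (digit_band_cylinder lam mu q n) <= (band_diam lam n)%:E)%E.
Proof.
suff loc x : digit_band_cylinder lam mu q n x ->
    engel_sum q n <= x <= engel_sum q n + band_diam lam n.
  apply: diam_le => x y /loc/andP[? ?] /loc/andP[? ?].
  by rewrite ler_norml; apply/andP; split; lra.
move=> [p [xp lammu pq]]; have [pP _] := (engel_expansionP _ _).1 xp.
have /andP[h1 h2] := engel_expansion_bounds x p n xp.
rewrite -(engel_sum_ext _ _ _ pq) (le_trans _ (ltW h1)) ?engel_sum_increasing//=.
rewrite (le_trans h2)// /engel_ub lerD2l div1r /band_diam expRN.
have p1 : 1 <= (p n.+1)%:R - 1 :> R by exact: engel_digit_sub1_ge1.
rewrite lef_pV2 ?posrE ?expR_gt0 ?mulr_gt0 ?engel_prod_gt0//; last lra.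
rewrite expRD ler_pM ?expR_ge0//.
  by apply: expR_psum_le_engel_prod => // k k1; case: (lammu k k1).
by rewrite -[leRHS]lnK ?ler_expR ?(lammu _ _).1// posrE; lra.
Qed.

(** Going from order [j + 1] back to order [j] costs a factor [exp (mu j.+1)],
    which bounds the number of admissible digits; subadditivity of the premeasure
    thus replaces an enumeration of the digit blocks. *)
Lemma premeasure_digit_band_cylinder lam mu s d n : 0 <= s ->
  band_diam lam n <= d -> forall i j q, (j + i)%N = n ->
  (hausdorff_premeasure s d (digit_band_cylinder lam mu q j) <=
    (expR (psum mu n - psum mu j) * band_diam lam n `^ s)%:E)%E.
Proof.
move=> s0 rd; elim => [|i IH] j q.
  rewrite addn0 => ->; rewrite subrr expR0 mul1r.
  by apply: hausdorff_premeasure_le_powR => //;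
    [rewrite expR_ge0|exact: diam_digit_band_cylinder].
rewrite addnS -addSn => jn.
pose D := Num.truncn (expR (mu j.+1)).
(* The value [e] stands for the digit [e + 1], as digits are positive. *)
pose q' e k := if k == j.+1 then e.+1 else q k.
pose F e := if (e < D)%N then digit_band_cylinder lam mu (q' e) j.+1 else set0.
have : digit_band_cylinder lam mu q j `<=` \bigcup_e F e.
  move=> x [p [xp lammu pq]]; have [pP _] := (engel_expansionP _ _).1 xp.
  have pj := engel_digit_gt p j.+1 pP isT.
  exists (p j.+1).-1 => //; rewrite /F ifT.
    exists p; split=> // k /andP[k1]; rewrite leq_eqVlt /q'.
    case: eqP => [-> _|_ /= kj]; first by rewrite prednK// (leq_ltn_trans _ pj).
    by rewrite pq// k1.
  rewrite /D truncn_gt_nat prednK ?(leq_ltn_trans _ pj)//.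
  have p0 : 0 < (p j.+1)%:R :> R by rewrite ltr0n (leq_ltn_trans _ pj).
  by rewrite -[leLHS]lnK ?posrE// ler_expR (lammu _ _).2.
move=> /(hausdorff_premeasure_sigma_subadditive s d)/le_trans; apply.
rewrite (nneseries_split 0 D); last by move=> *; exact: hausdorff_premeasure_ge0.
rewrite add0n [X in (_ + X)%E]eseries0 ?adde0; last first.
  by move=> k Dk _; rewrite /F ltnNge Dk/= hausdorff_premeasure0.
apply: (@le_trans _ _ (\sum_(0 <= e < D)
    (expR (psum mu n - psum mu j.+1) * band_diam lam n `^ s)%:E)%E).
  rewrite big_nat_cond [leRHS]big_nat_cond; apply: lee_sum => e.
  by rewrite andbT => /andP[_ eD]; rewrite /F eD; apply: IH.
rewrite sumEFin lee_fin sumr_const_nat subn0 -[_ *+ D]mulr_natl mulrA.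
rewrite ler_wpM2r ?powR_ge0//.
have -> : psum mu n - psum mu j = mu j.+1 + (psum mu n - psum mu j.+1).
  by rewrite psumS; lra.
by rewrite [leRHS]expRD ler_wpM2r ?expR_ge0// truncn_le// expR_ge0.
Qed.

Lemma premeasure_digit_band lam mu s d n : 0 <= s -> band_diam lam n <= d ->
  (hausdorff_premeasure s d (digit_band lam mu) <=
    (expR (psum mu n - s * (psum lam n + lam n.+1)))%:E)%E.
Proof.
move=> s0 rd.
have -> : expR (psum mu n - s * (psum lam n + lam n.+1)) =
    expR (psum mu n - psum mu 0) * band_diam lam n `^ s.
  by rewrite psum0 subr0 expRD -expRM; congr (_ * expR _); lra.
apply: le_trans
  (premeasure_digit_band_cylinder _ _ _ _ _ s0 rd n 0%N (fun=> 0%N) (add0n n)).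
apply: le_hausdorff_premeasure => x [p xp lammu].
by exists p; split=> // k /andP[k1 k0]; move: k1; rewrite leqNgt ltnS k0.
Qed.

End UpperCover.

(** * The upper bound *)

Section UpperBound.
Context {R : realType}.
Implicit Types (phi u L : nat -> R) (s d e C : R).

Definition ratio_set phi : set R := [set x : R | 0 < x <= 1 /\
  ln (modified_engel_ratio n x) / phi n @[n --> \oo] --> (1 : R)].

Lemma psum_affine (a b : R) u n :
  psum (fun k => a * u k + b) n = a * psum u n + n%:R * b.
Proof. by elim: n => [|n IH]; rewrite ?psum0 ?psumS ?IH -?natr1; lra. Qed.

(** A Cesaro type argument: the relative errors of the increments add up, except
    for the finitely many first ones, which go into [C]. *)
Lemma increments_approx phi L e : (forall n, (1 <= n)%N -> 0 <= phi n) -> 0 <= e ->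
  (\forall n \near \oo, `|L n.+1 - L n - phi n.+1| <= e * phi n.+1) ->
  exists C, forall n, `|L n - psum phi n| <= e * psum phi n + C.
Proof.
move=> phi0 e0 /near_nat[N LN]; exists (\sum_(k < N.+1) `|L k - psum phi k|).
elim=> [|n IH].
  rewrite psum0 subr0 mulr0 add0r big_ord_recl/= psum0 subr0 lerDl.
  exact: sumr_ge0.
have [Nn|nN] := leqP N n; last first.
  rewrite (bigD1 (Ordinal (nN : (n.+1 < N.+1)%N)))//= addrCA lerDl.
  by rewrite addr_ge0 ?sumr_ge0// mulr_ge0// psum_ge0.
have := LN _ Nn; rewrite !psumS !ler_norml; move: IH; rewrite ler_norml.
by move=> /andP[? ?] /andP[? ?]; apply/andP; split; lra.
Qed.

(** At the infinitely many [n] where [S (n+1)] exceeds [rho * T n] the cover by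
    cylinders of order [n] has total weight at most
    [exp (- kappa * T n + O(n))] with [kappa > 0]. *)
Lemma premeasure_digit_band0 phi s d e C rho :
  (forall n, (1 <= n)%N -> 0 < phi n) -> phi n @[n --> \oo] --> +oo ->
  0 < s -> 0 < d -> 0 <= e <= 1 -> 0 <= C ->
  1 + e < s * (1 - e) * (1 + rho) -> (rho%:E < theta phi)%E ->
  hausdorff_premeasure s d (digit_band (fun k => (1 - e) * psum phi k - C)
    (fun k => (1 + e) * psum phi k + C)) = 0%E.
Proof.
move=> phi0 phiy s0 d0 /andP[e0 e1] C0 kap rho_theta.
have phi0' n : (1 <= n)%N -> 0 <= phi n by move=> n1; exact/ltW/phi0.
set E := digit_band _ _.
suff small B : (hausdorff_premeasure s d E <= (expR (- B))%:E)%E.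
  apply/eqP; rewrite eq_le hausdorff_premeasure_ge0 andbT.
  apply/lee_addgt0Pr => eta eta0; rewrite add0e.
  by have := small (- ln eta); rewrite opprK lnK.
(* A large [B] also makes the sets of the cover smaller than [d], since the
   bound on their number is at least 1. *)
wlog Bd : B / - s * ln d <= B => [h|].
  have [/h//|BD] := leP (- s * ln d) B.
  apply: (le_trans (h _ (lexx _))); rewrite lee_fin ler_expR; lra.
set kappa := s * (1 - e) * (1 + rho) - (1 + e).
have kappa0 : 0 < kappa by rewrite subr_gt0.
have S0 n : (1 <= n)%N -> 0 <= psum phi n by move=> _; exact: psum_ge0.
have /near_nat[N TN] := psum_superlinear (psum phi)
  ((2 * C * (1 + s) + `|B|) / kappa) S0 (psum_cvgy _ phi0' phiy).
have [n Nn rhon] := theta_gt phi rho N.+1 rho_theta.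
have n1 : (1 <= n)%N by exact: leq_trans Nn.
have T0 : 0 < psum (psum phi) n.
  case: n n1 {Nn rhon} => // n _; rewrite psumS psumS.
  by rewrite ltr_wpDl ?psum_ge0// ltr_wpDl ?psum_ge0// phi0.
have Tn := TN n (ltnW Nn).
move: rhon; rewrite /theta_term ltr_pdivlMr// => rhon.
have n1R : 1 <= n%:R :> R by rewrite ler1n.
set T := psum (psum phi) n in T0 Tn rhon.
set S := psum phi n.+1 in rhon.
have kT : (2 * C * (1 + s) + `|B|) * n%:R <= kappa * T.
  by move: Tn; rewrite mulrAC ler_pdivrMr// [kappa * _]mulrC.
have BB := ler_norm B.
have expo : (1 + e) * T + n%:R * C
    - s * ((1 - e) * T + n%:R * - C + ((1 - e) * S - C)) <= - B.
  have h1 : s * (1 - e) * (rho * T) <= s * (1 - e) * S.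
    by rewrite ler_wpM2l ?mulr_ge0 ?(ltW s0) ?(ltW rhon)// subr_ge0.
  have h2 : 0 <= (C * (1 + s) + `|B|) * (n%:R - 1).
    by rewrite mulr_ge0 ?subr_ge0// addr_ge0// mulr_ge0// addr_ge0 // ltW.
  rewrite /kappa in kT; move: C0 h1 h2 kT BB; clear; lra.
set lam := fun k => (1 - e) * psum phi k - C.
set mu := fun k => (1 + e) * psum phi k + C.
have lamE : psum lam n + lam n.+1 =
    (1 - e) * T + n%:R * - C + ((1 - e) * S - C) by rewrite psum_affine.
have muE : psum mu n = (1 + e) * T + n%:R * C by rewrite psum_affine.
have diam_d : band_diam lam n <= d.
  rewrite /band_diam -[leRHS]lnK// ler_expR lerNl lamE -(ler_pM2l s0).
  have : 0 <= (1 + e) * T + n%:R * C.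
    by rewrite addr_ge0// mulr_ge0// ?addr_ge0// ltW.
  move: expo Bd; clear; lra.
apply: (le_trans (premeasure_digit_band lam mu s d n (ltW s0) diam_d)).
by rewrite lee_fin ler_expR lamE muE.
Qed.

(** When [x] has no expansion its digits all take the default value 0, so that the
    ratios vanish and the limit is 0, not 1. *)
Lemma ratio_set_expansion phi x : (forall n, (1 <= n)%N -> 0 < phi n) ->
  ratio_set phi x -> modified_engel_expansion x (modified_engel_digit x).
Proof.
move=> phi0 [_ xlim]; rewrite /modified_engel_digit.
have [[p xp]|noexp] := pselect (exists p, modified_engel_expansion x p).
  exact: (getI xp).
have d0 n : modified_engel_digit x n = 0%N.
  by rewrite /modified_engel_digit getPN// => p xp; apply: noexp; exists p.
suff /eqP : (1 : R) = 0 by rewrite oner_eq0.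
rewrite -(cvg_lim _ xlim)//; apply: lim_near_cst => //; apply: nearW => n.
by rewrite /modified_engel_ratio d0 mul0r ln0// mul0r.
Qed.

(** The bounds on [ln (p k)] come from summing the increments; passing to
    [ln (p k - 1)] costs at most [ln 2]. *)
Lemma ratio_set_sub_digit_bands phi e : (forall n, (1 <= n)%N -> 0 < phi n) ->
  0 < e ->
  ratio_set phi `<=` \bigcup_C digit_band (fun k => (1 - e) * psum phi k - C%:R)
    (fun k => (1 + e) * psum phi k + C%:R).
Proof.
move=> phi0 e0 x Ex; have := ratio_set_expansion _ _ phi0 Ex.
set p := modified_engel_digit x => xp.
have [pP _] := (engel_expansionP _ _).1 xp.
have p0 n : (1 <= n)%N -> 0 < (p n)%:R :> R.
  by move=> n1; rewrite ltr0n (leq_ltn_trans _ (engel_digit_gt p n pP n1)).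
have [|||C hC] := increments_approx phi (fun n => ln ((p n)%:R : R)) e.
- by move=> n n1; exact/ltW/phi0.
- exact: ltW.
- case: Ex => _ /cvgrPdist_le/(_ _ e0)/near_nat[N hN].
  apply/near_nat; exists N.+1 => n Nn.
  have := hN n.+1 (leqW (ltnW Nn)); rewrite /modified_engel_ratio -/p.
  have n1 : (1 <= n)%N by exact: leq_trans Nn.
  rewrite ln_div ?posrE ?p0//= => h.
  have ph := phi0 n.+1 isT.
  rewrite -ler_pdivrMr// -[X in _ / X]gtr0_norm// -normf_div -normrN.
  apply: le_trans h; rewrite le_eqVlt; apply/orP; left; apply/eqP.
  by congr `|_|; field; rewrite gt_eqF.
have [M hM] : exists M, C + 2 <= M%:R.
  by exists (Num.truncn (C + 2)).+1; apply/ltW/truncnS_gt.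
exists M => //; exists p => // k k1.
have := hC k; rewrite ler_norml => /andP[h1 h2]; split; last by lra.
have : ln (p k)%:R <= ln ((p k)%:R - 1 : R) + ln 2.
  have p1 : 1 <= (p k)%:R - 1 :> R by exact: engel_digit_sub1_ge1.
  by rewrite -lnM ?posrE ?ler_ln ?posrE ?p0//; lra.
have := ln_sublinear (ltr0Sn R 1).
by lra.
Qed.

(** With [a = s * (1 + rho) > 1], the choice of [e] in the proof ensures
    [1 + e < a * (1 - e)]. *)
Lemma hausdorff_measure_ratio_set0 phi s rho :
  (forall n, (1 <= n)%N -> 0 < phi n) -> phi n @[n --> \oo] --> +oo ->
  0 < s -> (rho%:E < theta phi)%E -> 1 < s * (1 + rho) ->
  hausdorff_measure s (ratio_set phi) = 0%E.
Proof.
move=> phi0 phiy s0 rho_theta h; set a := s * (1 + rho) in h.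
pose e := (a - 1) / (2 * (a + 1)).
have a1 : 0 < a + 1 by lra.
have eE : e * (a + 1) = (a - 1) / 2 by rewrite /e; field; rewrite gt_eqF.
have e0 : 0 < e by rewrite divr_gt0//; lra.
have e1 : e <= 1 by rewrite ler_pdivrMr//; lra.
apply: (hausdorff_measure_bigcup0 _ _ _ (ratio_set_sub_digit_bands _ _ phi0 e0)).
move=> C d d0; apply: (premeasure_digit_band0 _ _ _ _ _ rho) => //.
  by rewrite (ltW e0).
have -> : s * (1 - e) * (1 + rho) = a - e * a by rewrite /a; lra.
by lra.
Qed.

End UpperBound.

(** * A Cantor set of digit sequences *)

Section CantorDigits.
Context {R : realType}.
Implicit Types (b : nat -> nat) (z t K x y : R).

Definition digit_base b n : nat := (\prod_(1 <= k < n.+1) b k)%N.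
Definition level_size b n : nat := (\prod_(1 <= k < n.+1) digit_base b k)%N.
(** The index of the cell containing [z] when the unit interval is divided into
    [level_size b n] cells of equal length. *)
Definition cell b z n : nat := Num.truncn (z * (level_size b n)%:R).

(** The remainder is the [n]-th digit of [z] in the mixed radix system with bases
    [digit_base b 1], [digit_base b 2], and so on. *)
Definition cantor_digit b z n : nat :=
  (digit_base b n + cell b z n %% digit_base b n)%N.

Lemma digit_baseS b n : digit_base b n.+1 = (digit_base b n * b n.+1)%N.
Proof. by rewrite /digit_base big_nat_recr. Qed.

Lemma level_sizeS b n :
  level_size b n.+1 = (level_size b n * digit_base b n.+1)%N.
Proof. by rewrite /level_size big_nat_recr. Qed.

Lemma level_size0 b : level_size b 0 = 1%N.
Proof. by rewrite /level_size big_geq. Qed.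

Lemma digit_base_ge b n : (forall k, (1 <= k)%N -> (2 <= b k)%N) ->
  (2 ^ n <= digit_base b n)%N.
Proof.
move=> b2; elim: n => [|n IH]; first by rewrite /digit_base big_geq.
by rewrite digit_baseS expnSr leq_mul ?b2.
Qed.

Lemma digit_base_gt0 b n : (forall k, (1 <= k)%N -> (2 <= b k)%N) ->
  (0 < digit_base b n)%N.
Proof. by move=> b2; apply: leq_trans (digit_base_ge _ n b2); rewrite expn_gt0. Qed.

Lemma level_size_gt b n : (forall k, (1 <= k)%N -> (2 <= b k)%N) ->
  (n < level_size b n)%N.
Proof.
move=> b2; apply: (@leq_trans (2 ^ n)); first exact: ltn_expl.
elim: n => [|n IH]; first by rewrite level_size0.
rewrite level_sizeS expnSr leq_mul//.
by apply: leq_trans (digit_base_ge _ n.+1 b2); rewrite expnS leq_pmulr ?expn_gt0.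
Qed.

Lemma cantor_digit_bounds b z n : (forall k, (1 <= k)%N -> (2 <= b k)%N) ->
  (digit_base b n <= cantor_digit b z n < 2 * digit_base b n)%N.
Proof.
move=> b2; rewrite /cantor_digit leq_addr/= mul2n -addnn ltn_add2l ltn_mod.
exact: digit_base_gt0.
Qed.

Lemma cantor_digitsP b z : (forall k, (1 <= k)%N -> (2 <= b k)%N) ->
  engel_digits (cantor_digit b z).
Proof.
move=> b2; split.
  have /andP[+ _] := cantor_digit_bounds b z 1 b2.
  by apply: leq_trans; exact: (digit_base_ge _ 1 b2).
move=> n _; have /andP[_ h1] := cantor_digit_bounds b z n b2.
have /andP[h2 _] := cantor_digit_bounds b z n.+1 b2.
rewrite addn1 (leq_trans h1)// (leq_trans _ h2)// digit_baseS mulnC.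
by rewrite leq_mul2l b2 ?orbT.
Qed.

Lemma cell_divn b z n : (forall k, (1 <= k)%N -> (2 <= b k)%N) -> 0 <= z ->
  (cell b z n.+1 %/ digit_base b n.+1)%N = cell b z n.
Proof.
move=> b2 z0; have a0 := digit_base_gt0 b n.+1 b2.
have A0 m : 0 <= z * (level_size b m)%:R by rewrite mulr_ge0.
apply/eqP; rewrite eqn_leq; apply/andP; split.
  rewrite -ltnS ltn_divLR// /cell truncn_lt_nat// level_sizeS natrM mulrA.
  by rewrite natrM ltr_pM2r ?ltr0n// truncnS_gt.
rewrite leq_divRL// /cell truncn_ge_nat// level_sizeS !natrM mulrA.
by rewrite ler_pM2r ?ltr0n// truncn_le.
Qed.

Lemma cell0 b z : 0 <= z < 1 -> cell b z 0 = 0%N.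
Proof.
move=> /andP[z0 z1]; rewrite /cell level_size0 mulr1; apply/eqP.
by rewrite -leqn0 truncn_le_nat.
Qed.

Lemma le_cell b z z' n : z <= z' -> (cell b z n <= cell b z' n)%N.
Proof. by move=> zz'; rewrite le_truncn// ler_wpM2r. Qed.

(** Points that share a cell of order [n] but not one of order [n + 1] have the
    same first [n] digits; at order [n + 1] the difference of the digits is the
    difference of the cell indices, which controls [z' - z]. *)
Lemma cantor_digit_split b z z' : (forall k, (1 <= k)%N -> (2 <= b k)%N) ->
  0 <= z -> z < z' -> z' < 1 -> exists n,
  [/\ forall k, (1 <= k <= n)%N -> cantor_digit b z k = cantor_digit b z' k,
    (cantor_digit b z n.+1 < cantor_digit b z' n.+1)%N &
    z' - z <= ((cantor_digit b z' n.+1)%:R - (cantor_digit b z n.+1)%:R + 1)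
      / (level_size b n.+1)%:R].
Proof.
move=> b2 z0 zz' z1.
have z0' : 0 <= z' by exact: le_trans (ltW zz').
have : exists m, cell b z m != cell b z' m.
  exists (Num.truncn (z' - z)^-1).+1; set m := _.+1.
  have mz : 1 <= (z' - z) * (level_size b m)%:R.
    rewrite -ler_pdivrMl ?subr_gt0// mulr1 ltW//.
    apply: (lt_le_trans (truncnS_gt _)).
    by rewrite ler_nat ltnW// level_size_gt.
  apply/negP => /eqP cc.
  have := truncnS_gt (z' * (level_size b m)%:R); rewrite -/(cell b z' m) -cc.
  have : (cell b z m)%:R <= z * (level_size b m)%:R.
    by rewrite truncn_le// mulr_ge0.
  rewrite -natr1; lra.
move=> /ex_minnP[[|n] neq minn].
  by move: neq; rewrite !cell0 ?eqxx// ?z0 ?z0' ?(lt_trans zz').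
have eqc k : (k <= n)%N -> cell b z k = cell b z' k.
  by move=> kn; apply/eqP/negP => /negP/minn; rewrite ltnNge kn.
have ltc : (cell b z n.+1 < cell b z' n.+1)%N.
  by rewrite ltn_neqAle neq le_cell// ltW.
have diffE : (cantor_digit b z' n.+1)%:R - (cantor_digit b z n.+1)%:R =
    (cell b z' n.+1)%:R - (cell b z n.+1)%:R :> R.
  rewrite (divn_eq (cell b z' n.+1) (digit_base b n.+1)).
  rewrite (divn_eq (cell b z n.+1) (digit_base b n.+1)).
  by rewrite !cell_divn// eqc// /cantor_digit !natrD; lra.
exists n; split.
- by move=> k /andP[_ kn]; rewrite /cantor_digit eqc.
- by rewrite -(ltr_nat R) -subr_gt0 diffE subr_gt0 ltr_nat.
rewrite diffE ler_pdivlMr; last first.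
  by rewrite ltr0n (leq_ltn_trans _ (level_size_gt _ n.+1 b2)).
have := truncnS_gt (z' * (level_size b n.+1)%:R).
rewrite -/(cell b z' n.+1) -natr1.
have : (cell b z n.+1)%:R <= z * (level_size b n.+1)%:R.
  by rewrite truncn_le// mulr_ge0.
lra.
Qed.

Lemma engel_prod_cantor_le b z n : (forall k, (1 <= k)%N -> (2 <= b k)%N) ->
  engel_prod (cantor_digit b z) n <= 2 ^+ n * (level_size b n)%:R :> R.
Proof.
move=> b2; elim: n => [|n IH].
  by rewrite /engel_prod big_geq// level_size0 expr0 mulr1.
have pP := cantor_digitsP b z b2.
rewrite engel_prodS level_sizeS exprSr natrM mulrACA ler_pM//.
- exact/ltW/engel_prod_gt0.
- by rewrite (le_trans ler01)// engel_digit_sub1_ge1.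
have /andP[_] := cantor_digit_bounds b z n.+1 b2.
by rewrite -(ler_nat R) -natr1 natrM; lra.
Qed.

(** The general gap, with every digit replaced by the bounds [a k <= p k < 2 * a k].
    The ratio of two consecutive bases matters only for consecutive digits. *)
Lemma cantor_gap b z z' x y n : (forall k, (1 <= k)%N -> (2 <= b k)%N) ->
  modified_engel_expansion x (cantor_digit b z) ->
  modified_engel_expansion y (cantor_digit b z') ->
  (forall k, (1 <= k <= n)%N -> cantor_digit b z k = cantor_digit b z' k) ->
  (cantor_digit b z n.+1 < cantor_digit b z' n.+1)%N ->
  ((cantor_digit b z' n.+1)%:R - (cantor_digit b z n.+1)%:R - 1 
     + (digit_base b n.+1)%:R / (digit_base b n.+2)%:R)
    / (2 ^+ (n + 2) * (level_size b n)%:R * (digit_base b n.+1)%:R ^+ 2)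
    <= x - y.
Proof.
move=> b2 xz yz eqd ltd; set a : R := (digit_base b n.+1)%:R.
apply: le_trans (ltW (engel_expansion_gap _ _ _ _ _ xz yz eqd ltd)).
have u0 := engel_prod_gt0 (R := R) _ n (cantor_digitsP b z b2).
have uB := engel_prod_cantor_le b z n b2.
have A0 : 0 < (level_size b n)%:R :> R.
  by rewrite ltr0n (leq_ltn_trans _ (level_size_gt _ n b2)).
have a0 : 0 < a by rewrite ltr0n digit_base_gt0.
have a20 : 0 < (digit_base b n.+2)%:R :> R by rewrite ltr0n digit_base_gt0.
have := cantor_digit_bounds b z n.+1 b2.
have := cantor_digit_bounds b z' n.+1 b2.
have := cantor_digit_bounds b z n.+2 b2.
have := engel_digit_sub1_ge1 (R := R) _ n.+1 (cantor_digitsP b z b2) isT.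
have : (cantor_digit b z n.+1)%:R + 1 <= (cantor_digit b z' n.+1)%:R :> R.
  by rewrite natr1 ler_nat.
rewrite -!(ltr_nat R) -!(ler_nat R) !natrM -/a.
move: ((cantor_digit b z n.+1)%:R : R) => p.
move: ((cantor_digit b z' n.+1)%:R : R) => q.
move: ((cantor_digit b z n.+2)%:R : R) => r.
move: ((digit_base b n.+2)%:R : R) a20 => a2 a20.
move=> pq p1 /andP[r1 r2] /andP[q1 q2] /andP[pa1 pa2].
have pq1 : 0 <= q - 1 - p by lra.
have p0 : 0 < p by lra.
have q0 : 0 < q - 1 by lra.
have -> : 1 / p - 1 / (q - 1) + 1 / ((p - 1) * r) =
    (q - 1 - p) / (p * (q - 1)) + 1 / ((p - 1) * r).
  by field; rewrite !gt_eqF//; lra.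
have -> : (q - p - 1 + a / a2) / (2 ^+ (n + 2) * (level_size b n)%:R * a ^+ 2) =
    ((q - 1 - p) / (2 * a * (2 * a)) + 1 / (2 * a * (2 * a2)))
       / (2 ^+ n * (level_size b n)%:R).
  rewrite exprD; move: (2 ^+ n) (exprn_gt0 n (ltr0Sn R 1)) => w w0.
  by field; rewrite !gt_eqF//.
apply: ler_pM.
- by rewrite addr_ge0// divr_ge0// mulr_ge0//; lra.
- by rewrite invr_ge0 mulr_ge0// exprn_ge0.
- apply: lerD.
    rewrite ler_wpM2l// lef_pV2 ?posrE ?mulr_gt0//.
    by rewrite ler_pM//; lra.
  rewrite !div1r lef_pV2 ?posrE ?mulr_gt0//; [|lra..].
  by rewrite ler_pM//; lra.
- by rewrite lef_pV2 ?posrE// mulr_gt0// exprn_gt0.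
Qed.

End CantorDigits.

(** * The inverse Hoelder estimate *)

Section LowerBound.
Context {R : realType}.
Implicit Types (b : nat -> nat) (phi : nat -> R) (z t K x y : R).

Lemma powR_inv (w t : R) : 0 < w -> w^-1 `^ t = (w `^ t)^-1.
Proof.
move=> w0; have wt0 : w `^ t != 0 by rewrite gt_eqF// powR_gt0.
apply: (mulIf wt0).
by rewrite -powRM ?invr_ge0 ?ltW// mulVf ?gt_eqF// mulVf// powR1.
Qed.

(** A bound for the reciprocal of the smallest gap between points that first differ
    at place [n], and, up to a factor, of the gap between the extreme digits at
    place [n + 1]. *)
Definition gap_scale b n : R :=
  2 ^+ (n + 3) * (level_size b n)%:R * (digit_base b n.+1)%:R.

Lemma gap_scale_gt0 b n : (forall k, (1 <= k)%N -> (2 <= b k)%N) ->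
  0 < gap_scale b n.
Proof.
move=> b2; have A0 := leq_ltn_trans (leq0n n) (level_size_gt b n b2).
by rewrite /gap_scale !mulr_gt0 ?exprn_gt0// ltr0n// digit_base_gt0.
Qed.

(** For consecutive digits at place [n + 1] the hypothesis at [n + 1] compares the
    cell length with the smallest gap.  Otherwise, with [e] the difference of the
    digits and [a] the base, the left-hand side scales with [e / a <= 1] and the
    right-hand side with its [t]-th power, which is larger, so that the claim
    reduces to the hypothesis at [n]. *)
Lemma cantor_holder b z z' x y t K : (forall k, (1 <= k)%N -> (2 <= b k)%N) ->
  0 <= t <= 1 -> 0 < K ->
  (forall n, 2 * gap_scale b n `^ t <= K * (level_size b n)%:R) ->
  0 <= z < 1 -> 0 <= z' < 1 ->
  modified_engel_expansion x (cantor_digit b z) ->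
  modified_engel_expansion y (cantor_digit b z') ->
  `|z - z'| <= K * `|x - y| `^ t.
Proof.
move=> b2 t01 K0 HK.
wlog zz' : z z' x y / z < z' => [hw z1 z1' xz yz|].
  case: (ltgtP z z') => [zz'|z'z|zz']; first exact: hw.
    by rewrite distrC [`|x - y|]distrC; exact: hw.
  by rewrite zz' subrr normr0 mulr_ge0 ?powR_ge0 ?ltW.
move=> /andP[z0 _] /andP[_ z1] xz yz.
have [n [eqd ltd]] := cantor_digit_split b z z' b2 z0 zz' z1.
have := cantor_gap _ _ _ _ _ _ b2 xz yz eqd ltd.
rewrite [`|z - z'|]distrC [`|z' - z|]gtr0_norm ?subr_gt0//.
have A0 m : 0 < (level_size b m)%:R :> R.
  by rewrite ltr0n (leq_ltn_trans _ (level_size_gt _ m b2)).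
have a0 m : 0 < (digit_base b m)%:R :> R by rewrite ltr0n digit_base_gt0.
have := cantor_digit_bounds b z n.+1 b2.
have := cantor_digit_bounds b z' n.+1 b2.
have : (cantor_digit b z' n.+1)%:R - (cantor_digit b z n.+1)%:R = 1 :> R \/
    2 <= (cantor_digit b z' n.+1)%:R - (cantor_digit b z n.+1)%:R :> R.
  move: ltd; rewrite leq_eqVlt => /predU1P[<-|ltd].
    by left; rewrite -natr1; lra.
  right; move: ltd; rewrite -(ler_nat R) -natr1 -natr1; lra.
rewrite -!(ltr_nat R) -!(ler_nat R) !natrM.
set e : R := _%:R - _%:R.
rewrite level_sizeS natrM.
have HK0 := HK n; have HK1 := HK n.+1.
have w0 := gap_scale_gt0 b n b2; have w1 := gap_scale_gt0 b n.+1 b2.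
case=> [->|e2] /andP[q1 q2] /andP[p1 p2] gap zz.
  rewrite subrr add0r in gap.
  apply: (@le_trans _ _ (K * (gap_scale b n.+1)^-1 `^ t)); last first.
    rewrite ler_pM2l// ge0_ler_powR ?nnegrE ?invr_ge0 ?(ltW w1)//;
      first by case/andP: t01.
    apply: le_trans (ler_norm _); apply: le_trans gap.
    rewrite [leRHS](_ : _ = 4 * (gap_scale b n.+1)^-1).
      by rewrite ler_peMl ?invr_ge0 ?(ltW w1)// ler1n.
    rewrite /gap_scale level_sizeS natrM addSn 2!addnS addn0 addn3 !exprS.
    move: (2 ^+ n) (exprn_gt0 n (ltr0Sn R 1)) => w w0'.
    by field; rewrite !gt_eqF.
  apply: (le_trans zz); rewrite powR_inv// ler_pdivrMr ?mulr_gt0//.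
  rewrite -mulrA [_^-1 * _]mulrC mulrA ler_pdivlMr ?powR_gt0//.
  by move: HK1; rewrite level_sizeS natrM.
have e0 : 0 < e by lra.
have ea : e / (digit_base b n.+1)%:R <= 1 by rewrite ler_pdivrMr// /e; lra.
have ea0 : 0 < e / (digit_base b n.+1)%:R by rewrite divr_gt0.
apply: (@le_trans _ _ (K * (e / (digit_base b n.+1)%:R / gap_scale b n) `^ t));
    last first.
  rewrite ler_pM2l// ge0_ler_powR ?nnegrE ?divr_ge0 ?(ltW w0) ?(ltW e0)//;
      first by case/andP: t01.
  apply: le_trans (ler_norm _); apply: le_trans gap.
  rewrite [leRHS](_ : _ = 2 * (e - 1 + (digit_base b n.+1)%:R / (digit_base b n.+2)%:R)
      / (digit_base b n.+1)%:R / gap_scale b n).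
    rewrite ler_pM2r ?invr_gt0// ler_pM2r ?invr_gt0//.
    have : 0 < (digit_base b n.+1)%:R / (digit_base b n.+2)%:R :> R by rewrite divr_gt0.
    by lra.
  rewrite /gap_scale 2!addnS addn0 addn3 !exprS.
  move: (2 ^+ n) (exprn_gt0 n (ltr0Sn R 1)) => w w0'.
  by field; rewrite !gt_eqF.
rewrite powRM ?invr_ge0 ?(ltW ea0) ?(ltW w0)// powR_inv//.
apply: (@le_trans _ _ (K * (e / (digit_base b n.+1)%:R * (gap_scale b n `^ t)^-1)));
    last first.
  rewrite ler_pM2l// ler_pM2r ?invr_gt0 ?powR_gt0// ger1_powR ?ea0//.
  by case/andP: t01.
apply: (le_trans zz).
have -> : (e + 1) / ((level_size b n)%:R * (digit_base b n.+1)%:R) =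
    (e + 1) / (digit_base b n.+1)%:R / (level_size b n)%:R.
  by field; rewrite !gt_eqF.
apply: (@le_trans _ _ (e / (digit_base b n.+1)%:R * (2 / (level_size b n)%:R))).
  rewrite mulrA ler_pM2r ?invr_gt0// [e / _ * _]mulrAC ler_pM2r ?invr_gt0//.
  by lra.
rewrite [leRHS]mulrCA ler_pM2l// ler_pdivrMr// mulrAC ler_pdivlMr ?powR_gt0//.
Qed.

End LowerBound.

(** * The lower bound and the dimension *)

Section Dimension.
Context {R : realType}.
Implicit Types (phi : nat -> R) (t x z : R).

(** Within a factor 2 of the exponential, and at least 2 when [phi k > 0], so that
    the ranges from [a] to [2 * a] of consecutive digits do not overlap. *)
Definition exp_base phi k : nat := (Num.truncn (expR (phi k))).+1.

Lemma exp_base_ge2 phi : (forall n, (1 <= n)%N -> 0 < phi n) ->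
  forall k, (1 <= k)%N -> (2 <= exp_base phi k)%N.
Proof.
by move=> phi0 k k1; rewrite ltnS truncn_gt0 ltW// expR_gt1 phi0.
Qed.

Lemma ln2_le2 : ln 2 <= 2 :> R.
Proof. exact: ltW (ln_sublinear (ltr0Sn R 1)). Qed.

Lemma ln_exp_base phi k : 0 < phi k ->
  phi k <= ln ((exp_base phi k)%:R : R) <= phi k + 2.
Proof.
move=> phik; have e0 := expR_gt0 (phi k).
have e1 : 1 < expR (phi k) by rewrite expR_gt1.
rewrite -{1}(expRK (phi k)) ler_ln ?posrE ?ltr0n// ltW ?truncnS_gt//=.
apply: (@le_trans _ _ (ln (expR (phi k) * 2))).
  rewrite ler_ln ?posrE ?ltr0n ?mulr_gt0// -[leLHS]natr1.
  have : (Num.truncn (expR (phi k)))%:R <= expR (phi k) by rewrite truncn_le// ltW.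
  lra.
by rewrite lnM ?posrE// expRK lerD2l ln2_le2.
Qed.

Lemma ln_digit_base phi n : (forall n, (1 <= n)%N -> 0 < phi n) ->
  psum phi n <= ln ((digit_base (exp_base phi) n)%:R : R) <= psum phi n + 2 * n%:R.
Proof.
move=> phi0; elim: n => [|n IH].
  by rewrite /digit_base big_geq// ln1 psum0 mulr0 addr0 lexx.
rewrite psumS digit_baseS natrM lnM ?posrE ?ltr0n ?digit_base_gt0//; last first.
  exact: exp_base_ge2.
have := ln_exp_base phi n.+1 (phi0 n.+1 isT); rewrite -natr1.
by move: IH => /andP[? ?] /andP[? ?]; apply/andP; split; lra.
Qed.

Lemma ln_level_size_ge phi n : (forall n, (1 <= n)%N -> 0 < phi n) ->
  psum (psum phi) n <= ln ((level_size (exp_base phi) n)%:R : R).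
Proof.
move=> phi0; have b2 := exp_base_ge2 _ phi0.
elim: n => [|n IH]; first by rewrite level_size0 ln1 psum0.
have A0 : (0 < level_size (exp_base phi) n)%N.
  exact: leq_ltn_trans (leq0n n) (level_size_gt _ n b2).
rewrite psumS level_sizeS natrM lnM ?posrE ?ltr0n//; last exact: digit_base_gt0.
by apply: lerD => //; have /andP[] := ln_digit_base phi n.+1 phi0.
Qed.

(** The finitely many exceptions are absorbed in the constant. *)
Lemma near_dominated (u v : nat -> R) :
  (forall n, 0 <= u n) -> (forall n, 0 < v n) ->
  (\forall n \near \oo, u n <= v n) ->
  exists2 K, 0 < K & forall n, u n <= K * v n.
Proof.
move=> u0 v0 /near_nat[N uv]; exists (1 + \sum_(k < N) u k / v k).
  by rewrite ltr_pwDl// sumr_ge0// => k _; rewrite divr_ge0// ltW.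
move=> n; rewrite mulrDl mul1r; have [Nn|nN] := leqP N n.
  rewrite (le_trans (uv _ Nn))// lerDl mulr_ge0 ?(ltW (v0 n))//.
  by rewrite sumr_ge0// => k _; rewrite divr_ge0// ltW.
apply: (@le_trans _ _ (u n / v n * v n)); first by rewrite divfK// gt_eqF.
apply: (@le_trans _ _ ((\sum_(k < N) u k / v k) * v n)); last by rewrite lerDr ltW.
rewrite ler_pM2r// (bigD1 (Ordinal nN))//= lerDl.
by rewrite sumr_ge0// => k _; rewrite divr_ge0// ltW.
Qed.

(** In logarithms the claim is [t * (T n + S (n+1)) <= T n] up to terms linear in
    [n]; as [S (n+1) <= r * T n] eventually, the margin
    [(1 - t * (1 + r)) * T n] absorbs these. *)
Lemma gap_scale_dominated phi t r :
  (forall n, (1 <= n)%N -> 0 < phi n) -> phi n @[n --> \oo] --> +oo ->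
  0 <= t <= 1 -> (theta phi < r%:E)%E -> t * (1 + r) < 1 ->
  exists2 K, 0 < K & forall n, 2 * gap_scale (exp_base phi) n `^ t <=
    K * (level_size (exp_base phi) n)%:R.
Proof.
move=> phi0 phiy /andP[t0 t1] theta_r tr; have b2 := exp_base_ge2 _ phi0.
have phi0' n : (1 <= n)%N -> 0 <= phi n by move=> n1; exact/ltW/phi0.
have A0 n : (0 < level_size (exp_base phi) n)%N.
  exact: leq_ltn_trans (leq0n n) (level_size_gt _ n b2).
apply: near_dominated => [n|n|]; [by rewrite mulr_ge0 ?powR_ge0|by rewrite ltr0n|].
have S0 n : (1 <= n)%N -> 0 <= psum phi n by move=> _; exact: psum_ge0.
(* The linear terms amount to at most [4 * n + 10 <= 14 * n]. *)
set kappa := 1 - t * (1 + r); have kappa0 : 0 < kappa by rewrite subr_gt0.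
have := psum_superlinear (psum phi) (14 / kappa) S0 (psum_cvgy _ phi0' phiy).
move=> /near_nat[N TN]; have /near_nat[M thetaM] := theta_lt _ _ theta_r.
apply/near_nat; exists (maxn N M).+1 => n; rewrite ltnNge; move/negP/negP.
rewrite -ltnNge gtn_max => /andP[Nn Mn].
have n1 : (1 <= n)%N by exact: leq_trans Nn.
have n1R : 1 <= n%:R :> R by rewrite ler1n.
have T0 : 0 < psum (psum phi) n.
  case: n n1 {Nn Mn n1R} => // n _; rewrite psumS psumS.
  by rewrite ltr_wpDl ?psum_ge0// ltr_wpDl ?psum_ge0// phi0.
have := TN _ (ltnW Nn); rewrite mulrAC ler_pdivrMr// mulrC.
have := thetaM _ (ltnW Mn); rewrite /theta_term ltr_pdivrMr// => ST kT.
have AT := ln_level_size_ge phi n phi0.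
have /andP[_ aS] := ln_digit_base phi n.+1 phi0.
have a0 : 0 < (digit_base (exp_base phi) n.+1)%:R :> R by rewrite ltr0n digit_base_gt0.
have A0R : 0 < (level_size (exp_base phi) n)%:R :> R by rewrite ltr0n.
have w0 : 0 < gap_scale (exp_base phi) n := gap_scale_gt0 _ n b2.
rewrite -ler_ln ?posrE ?mulr_gt0 ?powR_gt0// lnM ?posrE ?powR_gt0// ln_powR.
rewrite /gap_scale !lnM ?posrE ?mulr_gt0 ?exprn_gt0//.
rewrite lnXn// -[ln 2 *+ _]mulr_natr natrD.
move: AT aS; rewrite -[n.+1%:R]natr1.
set lA := ln _; set la := ln (digit_base _ _)%:R => AT aS.
have l2 := ln2_le2.
have h1 : ln 2 * (n%:R + 3%:R) <= 2 * (n%:R + 3%:R) :> R.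
  by rewrite ler_wpM2r// addr_ge0.
have h2 : t * (ln 2 * (n%:R + 3%:R) + lA + la) <=
   t * (2 * (n%:R + 3%:R) + lA + (r * psum (psum phi) n + 2 * (n%:R + 1))).
  by rewrite ler_wpM2l//; lra.
have h3 : (1 - t) * psum (psum phi) n <= (1 - t) * lA.
  by rewrite ler_wpM2l// subr_ge0.
have h4 : t * (4 * n%:R + 8) <= 4 * n%:R + 8.
  by rewrite ler_piMl// addr_ge0// mulr_ge0.
rewrite /kappa in kT; lra.
Qed.

(** The logarithm of a ratio differs from [phi n] by a bounded amount: each digit
    is within a factor 2 of its base, and each [exp_base] of its exponential. *)
Lemma cantor_sub_ratio_set phi z x : (forall n, (1 <= n)%N -> 0 < phi n) ->
  phi n @[n --> \oo] --> +oo ->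
  modified_engel_expansion x (cantor_digit (exp_base phi) z) -> ratio_set phi x.
Proof.
move=> phi0 phiy xz; split; first exact: engel_expansion_itv xz.
have b2 := exp_base_ge2 _ phi0.
apply/cvgrPdist_le => e e0; move/cvgryPge : phiy => /(_ (6 / e))/near_nat[N phiN].
apply/near_nat; exists N.+2 => n Nn.
case: n Nn => [//|n]; rewrite ltnS => Nn.
have n1 : (1 <= n)%N by exact: leq_trans Nn.
rewrite /modified_engel_ratio !(modified_engel_digitE _ _ xz)//=.
have a0 m : 0 < (digit_base (exp_base phi) m)%:R :> R by rewrite ltr0n digit_base_gt0.
have lnp m : ln ((digit_base (exp_base phi) m)%:R : R) <=
    ln ((cantor_digit (exp_base phi) z m)%:R : R) <=
    ln ((digit_base (exp_base phi) m)%:R : R) + 2.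
  have /andP[p1 p2] := cantor_digit_bounds (exp_base phi) z m b2.
  have p0 : 0 < (cantor_digit (exp_base phi) z m)%:R :> R.
    by rewrite ltr0n (leq_trans _ p1)// digit_base_gt0.
  rewrite ler_ln ?posrE ?ler_nat// p1/=.
  apply: (@le_trans _ _ (ln ((digit_base (exp_base phi) m)%:R * 2 : R))).
    rewrite ler_ln ?posrE ?mulr_gt0//.
    by move: p2; rewrite -(ltr_nat R) natrM; lra.
  by rewrite lnM ?posrE// lerD2l ln2_le2.
have p0 m : 0 < (cantor_digit (exp_base phi) z m)%:R :> R.
  have /andP[p1 _] := cantor_digit_bounds (exp_base phi) z m b2.
  by rewrite ltr0n (leq_trans _ p1)// digit_base_gt0.
rewrite ln_div ?posrE//.
have := lnp n.+1; rewrite digit_baseS natrM lnM ?posrE ?a0 ?ltr0n//.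
have phin := phi0 n.+1 isT.
have := ln_exp_base phi n.+1 phin; have := lnp n.
have := phiN n.+1 (leqW (ltnW Nn)); rewrite ler_pdivrMr//.
set L1 := ln (cantor_digit _ _ n.+1)%:R; set L0 := ln (cantor_digit _ _ n)%:R.
move=> h /andP[h1 h2] /andP[h3 h4] /andP[h5 h6].
have -> : 1 - (L1 - L0) / phi n.+1 = (phi n.+1 - (L1 - L0)) / phi n.+1.
  by field; rewrite gt_eqF.
rewrite normrM normfV (gtr0_norm phin) ler_pdivrMr// ler_norml.
by apply/andP; split; lra.
Qed.

Lemma hausdorff_measure_ratio_set_gt0 phi t r :
  (forall n, (1 <= n)%N -> 0 < phi n) -> phi n @[n --> \oo] --> +oo ->
  0 <= t <= 1 -> (theta phi < r%:E)%E -> t * (1 + r) < 1 ->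
  (0 < hausdorff_measure t (ratio_set phi))%E.
Proof.
move=> phi0 phiy t01 theta_r tr; have b2 := exp_base_ge2 _ phi0.
have [K K0 HK] := gap_scale_dominated _ _ _ phi0 phiy t01 theta_r tr.
have [g gP] : {g : R -> R & forall z,
    modified_engel_expansion (g z) (cantor_digit (exp_base phi) z)}.
  apply: (@choice _ _ (fun z x =>
    modified_engel_expansion x (cantor_digit (exp_base phi) z))) => z.
  exact/engel_expansion_exists/cantor_digitsP.
apply: (hausdorff_measure_gt0 _ K g) => //;
      first by case/andP: t01.
  by move=> z _; exact: cantor_sub_ratio_set (gP z).
by move=> z z' z01 z01'; apply: cantor_holder (gP z) (gP z').
Qed.

(** The measure of exponent [s] vanishes when [s * (1 + theta) > 1] and is positive
    when [s * (1 + theta) < 1]; the auxiliary exponents leave room for the strict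
    inequalities, including when [theta] is infinite. *)
Lemma hausdorff_dim_ratio_set phi :
  (forall n, (1 <= n)%N -> 0 < phi n) -> phi n @[n --> \oo] --> +oo ->
  hausdorff_dim (ratio_set phi) = ((1 + theta phi)^-1)%E.
Proof.
move=> phi0 phiy; have th0 := theta_ge0 _ phi0.
apply/eqP; rewrite eq_le; apply/andP; split.
  have upper s rho : 0 < s -> (rho%:E < theta phi)%E -> 1 < s * (1 + rho) ->
      (hausdorff_dim (ratio_set phi) <= s%:E)%E.
    move=> s0 hr hs; apply: ereal_inf_lbound; exists s => //.
    split; first exact: ltW.
    exact: hausdorff_measure_ratio_set0 hs.
  case: (theta phi) th0 upper => [th| |//] th0 upper; last first.
    rewrite addey// invey; apply/lee_addgt0Pr => s s0; rewrite add0e.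
    apply: (upper s s^-1) => //; first by rewrite ltey.
    by rewrite mulrDr mulr1 mulfV ?gt_eqF//; lra.
  have th1 : 0 < 1 + th by rewrite ltr_wpDr.
  rewrite -EFinD inver gt_eqF//; apply/lee_addgt0Pr => d d0; rewrite -EFinD.
  set s := _ + d; have s0 : 0 < s by rewrite addr_gt0// invr_gt0.
  have hs : s^-1 < 1 + th by rewrite -[ltRHS]invrK ltf_pV2 ?posrE ?invr_gt0// ltrDl.
  apply: (upper s ((s^-1 + (1 + th)) / 2 - 1)) => //; first by rewrite lte_fin; lra.
  by rewrite -[ltLHS](mulfV (lt0r_neq0 s0)) ltr_pM2l//; lra.
apply: le_ereal_inf_tmp => _ [t [t0 Ht] <-].
rewrite leNgt; apply/negP => htheta.
case: (theta phi) (@hausdorff_measure_ratio_set_gt0 phi t) th0 htheta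
    => [th| |//] lower th0; last by rewrite addey// invey lte_fin ltNge t0.
have th1 : 0 < 1 + th by rewrite ltr_wpDr.
rewrite -EFinD inver gt_eqF// lte_fin => tth.
have h1 : t * (1 + th) < 1 by rewrite -ltr_pdivlMr// div1r.
have t1 : t <= 1 by apply: (le_trans (ltW tth)); rewrite invf_le1// lerDl.
have := lower (th + (1 - t * (1 + th)) / 2) phi0 phiy.
rewrite Ht ltxx t0 t1 lte_fin => /(_ isT).
suff [-> ->] : th < th + (1 - t * (1 + th)) / 2 /\
    t * (1 + (th + (1 - t * (1 + th)) / 2)) < 1 by move=> /(_ isT isT).
split; first lra.
have : t * ((1 - t * (1 + th)) / 2) <= (1 - t * (1 + th)) / 2.
  by rewrite ler_piMl//; lra.
lra.
Qed.

End Dimension.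

(* In \bar R one has +oo^-1 = 0, so the right-hand side is 0 when
   theta phi = +oo. *)
Theorem theorem6p1 (R : realType) (phi : nat -> R)
    (phi_gt0 : forall n : nat, (1 <= n)%N -> 0 < phi n)
    (phi_infty : phi n @[n --> \oo] --> +oo) :
  hausdorff_dim [set x : R | 0 < x <= 1 /\
    ln (modified_engel_ratio n x) / phi n @[n --> \oo] --> (1 : R)] =
  ((1 + theta phi)^-1)%E.
Proof. exact: hausdorff_dim_ratio_set. Qed.
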